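(* Fix integers $t \geq 2$ and $d \ge 1$. There is a constant $C = C(t,d)$ such that the following holds. Let $q$ be an even power of an odd prime with $d \mid q-1$, and let $a \leq h$ be positive integers with $ha = \frac{q-1}{d}$. Then \[ f\!\left(q^{t-1} a,\; K_{t,(t-1)!\, d^{t-1} + 1}\right) \leq a + h + C h^{2/5}, \] i.e. $f(q^{t-1}a, K_{t,(t-1)!d^{t-1}+1}) \le a + h + O(h^{2/5})$.
   Context: Let $r,k$ be positive integers. A graph $G$ is an $(r,k)$-graph if $V(G)$ can be partitioned into sets $V_1,\dots,V_r$ with $|V_i| \le k$ for all $i$ such that for every pair $i \neq j$ in $[r]$ there is an edge of $G$ with one endpoint in $V_i$ and the other in $V_j$. For a graph $H$, $f(r,H)$ is the minimum $k$ such that there exists an $H$-free $(r,k)$-graph. $K_{s,t}$ is the complete bipartite graph with parts of sizes $s$ and $t$. *)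

(* Defs.v *)
From mathcomp Require Import all_boot.

Set Implicit Arguments.
Unset Strict Implicit.
Unset Printing Implicit Defensive.

Record sgraph := SGraph {
  vertex :> finType;
  adj : rel vertex;
  adj_sym : symmetric adj;
  adj_irr : irreflexive adj
}.

Definition Kbip_adj (s t : nat) : rel ('I_s + 'I_t) :=
  fun x y => match x, y with
             | inl _, inr _ | inr _, inl _ => true
             | _, _ => false
             end.

Lemma Kbip_sym (s t : nat) : symmetric (@Kbip_adj s t).
Proof. by case=> i [] j. Qed.

Lemma Kbip_irr (s t : nat) : irreflexive (@Kbip_adj s t).
Proof. by case. Qed.

Definition Kbip (s t : nat) : sgraph :=
  SGraph (@Kbip_sym s t) (@Kbip_irr s t).

(* Subgraph containment, not necessarily induced. *)
Definition contains (G H : sgraph) : Prop :=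
  exists phi : H -> G,
    injective phi /\ forall x y : H, adj x y -> adj (phi x) (phi y).

Definition is_free (H G : sgraph) : Prop := ~ contains G H.

(* The parts are an indexed family, so that none of finset's nonemptiness
   requirement on the blocks of [partition] is imposed. *)
Definition is_rk_graph (r k : nat) (G : sgraph) : Prop :=
  exists V : 'I_r -> {set G},
    [/\ \bigcup_(i < r) V i = [set: G],
        forall i j : 'I_r, i != j -> [disjoint V i & V j],
        forall i : 'I_r, #|V i| <= k
      & forall i j : 'I_r, i != j ->
          exists x y : G, [/\ x \in V i, y \in V j & adj x y]].

Definition has_free_rk_graph (r : nat) (H : sgraph) (k : nat) : Prop :=
  0 < k /\ exists G : sgraph, is_rk_graph r k G /\ is_free H G.

(* [f_is r H k] says that f(r, H) is defined and equal to k: for some H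
   (e.g. a single edge, when r >= 2) no k admits an H-free (r, k)-graph, so f
   is a functional relation rather than a total function. *)
Definition f_is (r : nat) (H : sgraph) (k : nat) : Prop :=
  has_free_rk_graph r H k /\
  forall k' : nat, has_free_rk_graph r H k' -> k <= k'.

(* Main.v *)
Require Import Defs.
From mathcomp Require Import all_boot all_order all_algebra.
From mathcomp Require Import reals exp.
From mathcomp Require Import all_fingroup all_solvable all_field.
From mathcomp Require Import boolp ring zify.

Set Implicit Arguments.
Unset Strict Implicit.
Unset Printing Implicit Defensive.

Import Order.TTheory GRing.Theory Num.Theory.
Local Open Scope ring_scope.

(* Let n = t - 1, let F be the field with q^n elements, w an element of order
   m = h a of F and e = (q^n - 1)/m, so that z^e = N(z)^d for the norm N of F
   over the field with q elements.  In the bipartite graph on two copies of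
   F x Z_m where (A, x) and (B, y) are adjacent iff (A - B)^e = w^(x + y), the
   pair (A, i), i < a, receives the h left vertices (A, i + a k) and the a right
   vertices (A, i a + l), l < a (disjoint since a <= h).  As every residue mod
   m is some a k + l, any two such parts with distinct first coordinates are
   joined by an edge.  Parts with the same first coordinate are joined
   by adding, for each A, a C4-free graph with a parts of size O(h^(2/5)); it
   is an incidence graph of points and lines over a field of order 4^k, whose
   additive group is tiled by two sets of size 2^k.

   For the K_{t,s}-freeness, the change of variable z = 1/(A_0 - B) turns the
   common neighbours (B, y) of t vertices into the solutions of d^n systems
   prod_(j < n) (z^(q^j) + alpha_i^(q^j)) = b_i, i < n, with b_i <> 0.  More
   generally, prod_(j < n) (x_j - a_ij) = b_i has at most n! solutions as soon
   as the entries in each column of (a_ij) are distinct: call "box" the space of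
   polynomials in x_0, ..., x_(n-2) of degree at most j + 1 in x_j, which has
   dimension n!.  By Lagrange interpolation in the last variable and induction,
   box polynomials are combinations sum_i h_i prod_(j < n-1) (x_j - a_ij) with
   h_i of degree at most j in x_j.  Hence, on the solutions, box is stable
   under multiplication by x_(n-1); by induction on the slices on which x_(n-1)
   is constant, box restricts onto all functions on the set of solutions. *)

(** * Systems of products of linear forms *)

Section BoxPolynomials.
Variable K : fieldType.
Implicit Types (f g : (nat -> K) -> K) (x : nat -> K).

(* [f] depends polynomially on [x 0, ..., x (n - 1)], with degree at most
   [j + d] in [x j]. *)
Fixpoint boxpoly (d n : nat) f : Prop :=
  if n is k.+1 then
    exists g : nat -> (nat -> K) -> K,
      (forall e, boxpoly d k (g e)) /\
      (forall x, f x = \sum_(e < k.+1 + d) g e x * x k ^+ e)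
  else exists c, forall x, f x = c.

Lemma boxpoly_ext d n f g : f =1 g -> boxpoly d n f -> boxpoly d n g.
Proof.
case: n => [|n] fg /=; first by case=> c fc; exists c => x; rewrite -fg.
by case=> u [bu fu]; exists u; split=> // x; rewrite -fg.
Qed.

Lemma boxpoly_const d n c : boxpoly d n (fun=> c).
Proof.
elim: n c => [|n IHn] c; first by exists c.
exists (fun e => if e is 0 then fun=> c else fun=> 0); split=> [[|e]|x] //.
rewrite addSn big_ord_recl expr0 mulr1 big1 ?addr0 // => i _.
by rewrite mul0r.
Qed.

Lemma boxpolyD d n f g :
  boxpoly d n f -> boxpoly d n g -> boxpoly d n (fun x => f x + g x).
Proof.
elim: n f g => [|n IHn] f g /=.
  by move=> [c fc] [c' gc]; exists (c + c') => x; rewrite fc gc.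
move=> [u [bu fu]] [v [bv gv]]; exists (fun e x => u e x + v e x).
split=> [e|x]; first exact: IHn.
by rewrite fu gv -big_split; apply: eq_bigr => e _; rewrite mulrDl.
Qed.

Lemma boxpolyZ d n c f : boxpoly d n f -> boxpoly d n (fun x => c * f x).
Proof.
elim: n f => [|n IHn] f /=.
  by move=> [c' fc]; exists (c * c') => x; rewrite fc.
move=> [u [bu fu]]; exists (fun e x => c * u e x).
split=> [e|x]; first exact: IHn.
by rewrite fu mulr_sumr; apply: eq_bigr => e _; rewrite mulrA.
Qed.

Lemma boxpoly_sum d n (I : Type) (r : seq I) (P : pred I)
    (F : I -> (nat -> K) -> K) :
  (forall i, P i -> boxpoly d n (F i)) ->
  boxpoly d n (fun x => \sum_(i <- r | P i) F i x).
Proof.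
move=> bF; elim: r => [|i r IHr].
  by apply: boxpoly_ext (boxpoly_const d n 0) => x; rewrite big_nil.
have [Pi|nPi] := boolP (P i).
  apply: boxpoly_ext (boxpolyD (bF i Pi) IHr) => x.
  by rewrite big_cons Pi.
by apply: boxpoly_ext IHr => x; rewrite big_cons (negPf nPi).
Qed.

Lemma boxpoly_mul_last d n f (p : {poly K}) :
  (size p <= n.+1 + d)%N -> boxpoly d n f ->
  boxpoly d n.+1 (fun x => f x * p.[x n]).
Proof.
move=> sp bf; exists (fun e x => p`_e * f x); split=> [e|x].
  exact: boxpolyZ.
rewrite (horner_coef_wide _ sp) mulr_sumr; apply: eq_bigr => e _.
by rewrite mulrCA mulrA.
Qed.

Lemma boxpoly_lift d n f : boxpoly d n f -> boxpoly d n.+1 f.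
Proof.
move=> bf.
have s1 : (size (1%R : {poly K}) <= n.+1 + d)%N by rewrite size_poly1.
by apply: boxpoly_ext (boxpoly_mul_last s1 bf) => x; rewrite hornerC mulr1.
Qed.

Lemma boxpoly_degS d n f : boxpoly d n f -> boxpoly d.+1 n f.
Proof.
elim: n f => [|n IHn] f //= [u [bu fu]].
have b e : (e < n.+1 + d)%N -> boxpoly d.+1 n.+1 (fun x => u e x * x n ^+ e).
  move=> lt_e; have sX : (size ('X^e : {poly K}) <= n.+1 + d.+1)%N.
    by rewrite size_polyXn addnS ltnS ltnW.
  by apply: boxpoly_ext (boxpoly_mul_last sX (IHn _ (bu e))) => x;
     rewrite hornerXn.
have bs := boxpoly_sum (index_enum 'I_(n.+1 + d))
             (fun (i : 'I__) (_ : true) => b _ (ltn_ord i)).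
exact: boxpoly_ext bs.
Qed.

Lemma boxpoly_mul_linear n f (a : nat -> K) :
  boxpoly 0 n f -> boxpoly 1 n (fun x => f x * \prod_(j < n) (x j - a j)).
Proof.
elim: n f => [|n IHn] f.
  by case=> c fc; exists c => x; rewrite big_ord0 mulr1.
case=> u [bu fu].
have b (e : 'I_(n.+1 + 0)) : true -> boxpoly 1 n.+1 (fun x =>
    (u e x * \prod_(j < n) (x j - a j)) * ('X^e * ('X - (a n)%:P)).[x n]).
  move=> _; apply: boxpoly_mul_last (IHn _ (bu e)).
  rewrite mulrC size_mulXn ?polyXsubC_eq0 // size_XsubC.
  by case: e => e /=; rewrite addn0 addn1 addn2.
apply: boxpoly_ext (boxpoly_sum (index_enum _) b) => x.
rewrite fu mulr_suml; apply: eq_bigr => e _.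
rewrite big_ord_recr /= hornerM hornerXn hornerXsubC !mulrA.
by congr (_ * _); rewrite mulrAC.
Qed.

Lemma size_prod_XsubC_set (I : finType) (A : {set I}) (z : I -> K) :
  size (\prod_(l in A) ('X - (z l)%:P)) = #|A|.+1.
Proof. by rewrite -big_enum size_prod_XsubC -cardE. Qed.

Lemma horner_prod_XsubC (I : finType) (A : {set I}) (z : I -> K) y :
  (\prod_(l in A) ('X - (z l)%:P)).[y] = \prod_(l in A) (y - z l).
Proof.
by rewrite horner_prod; apply: eq_bigr => l _; rewrite hornerXsubC.
Qed.

Lemma lagrange_interpolation (I : finType) (A : {set I}) (z : I -> K)
    (p : {poly K}) y :
  {in A &, injective z} -> (size p <= #|A|)%N ->
  p.[y] = \sum_(k in A) (\prod_(l in A :\ k) (z k - z l))^-1 * p.[z k] *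
                        \prod_(l in A :\ k) (y - z l).
Proof.
move=> z_inj sp.
pose w k := (\prod_(l in A :\ k) (z k - z l))^-1 * p.[z k].
pose r := \sum_(k in A) w k *: \prod_(l in A :\ k) ('X - (z l)%:P).
have rE c : r.[c] = \sum_(k in A) w k * \prod_(l in A :\ k) (c - z l).
  rewrite horner_sum; apply: eq_bigr => k _.
  by rewrite hornerZ horner_prod_XsubC.
rewrite -rE; suff -> : p = r by [].
(* Otherwise [p - r] is a nonzero polynomial of size at most [#|A|] with [#|A|] distinct roots. *)
apply/eqP; rewrite -subr_eq0; apply/eqP; apply: contraTeq sp => pr_neq0.
rewrite -ltnNge; have sr : (size r <= #|A|)%N.
  apply: (leq_trans (size_sum _ _ _)); apply/bigmax_leqP => k kA.
  apply: (leq_trans (size_scale_leq _ _)).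
  by rewrite size_prod_XsubC_set (cardsD1 k A) kA.
have rt : all (root (p - r)) [seq z k | k in A].
  apply/allP => _ /imageP[k kA ->]; rewrite rootE hornerD hornerN rE.
  rewrite (bigD1 k) //=.
  rewrite [\sum_(_ in A | _) _]big1 ?addr0 => [|l /andP[lA lk]].
    rewrite /w mulrAC mulVf ?mul1r ?subrr //.
    apply/prodf_neq0 => l /setD1P[lk lA]; rewrite subr_eq0.
    by apply: contra lk => /eqP/z_inj -> .
  by rewrite (bigD1 k) /= ?subrr ?mul0r ?mulr0 // !inE eq_sym lk.
have ur : uniq [seq z k | k in A].
  rewrite map_inj_in_uniq ?enum_uniq // => i j.
  by rewrite !mem_enum; apply: z_inj.
have := max_poly_roots pr_neq0 rt ur; rewrite size_image => ltA.
rewrite ltnNge; apply: contraL ltA => sp; rewrite -leqNgt.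
by rewrite (leq_trans (size_polyD _ _)) // size_polyN geq_max sp sr.
Qed.

(** The spanning family consists of monomials, with [j.+1 + d] exponents for [x j]. For [d = 1] the
    count is (n + 1)!, the bound wanted on the number of solutions. *)
Lemma boxpoly_span d n :
  exists (I : finType) (mon : I -> (nat -> K) -> K),
    #|I| = \prod_(j < n) (j.+1 + d)%N /\
    forall f, boxpoly d n f ->
      exists c : I -> K, forall x, f x = \sum_i c i * mon i x.
Proof.
elim: n => [|n [I [mon [cI IHn]]]].
  exists unit, (fun _ _ => 1); rewrite card_unit big_ord0; split=> // f [c fc].
  by exists (fun=> c) => x; rewrite big_const card_unit /= addr0 mulr1.
exists ('I_(n.+1 + d) * I)%type, (fun p x => x n ^+ (p.1 : 'I__) * mon p.2 x).
split; first by rewrite card_prod card_ord cI big_ord_recr mulnC.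
move=> f [u [bu fu]].
have /fin_all_exists[c uc] (e : 'I_(n.+1 + d)) := IHn _ (bu e).
exists (fun p => c p.1 p.2) => x; rewrite fu.
rewrite -(pair_big xpredT xpredT (fun e i => c e i * (x n ^+ e * mon i x))) /=.
apply: eq_bigr => e _; rewrite uc mulr_suml; apply: eq_bigr => i _.
by rewrite -mulrA [mon i x * _]mulrC.
Qed.

(** Induction on [n]: the step interpolates in the last variable at the nodes [a k n] and expands
    the value at node [k] over [A :\ k]. For each [i] used, the Lagrange numerator contains
    [x n - a i n], which completes the [i]-th product and leaves the cofactor [L k i], of one degree
    less. *)
Lemma boxpoly_span_linear_products (I : finType) n (A : {set I})
    (a : I -> nat -> K) f :
  #|A| = n.+1 ->
  {in A &, forall i k, i != k -> forall j, (j < n)%N -> a i j != a k j} ->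
  boxpoly 1 n f ->
  exists h : I -> (nat -> K) -> K,
    (forall i, boxpoly 0 n (h i)) /\
    forall x, f x = \sum_(i in A) h i x * \prod_(j < n) (x j - a i j).
Proof.
elim: n A f => [|n IHn] A f cA a_inj bf.
  have /cards1P[i0 ->] : #|A| == 1%N by rewrite cA.
  exists (fun=> f); split=> [i|x]; first exact: bf.
  by rewrite big_set1 big_ord0 mulr1.
have [u [bu fu]] := bf.
have slice k : exists h : I -> (nat -> K) -> K, k \in A ->
    (forall i, boxpoly 0 n (h i)) /\
    forall x, \sum_(e < n.+1 + 1) (a k n) ^+ e * u e x =
      \sum_(i in A :\ k) h i x * \prod_(j < n) (x j - a i j).
  have [kA|kA] := boolP (k \in A); last by exists (fun _ _ => 0).
  have cAk : #|A :\ k| = n.+1 by have := cardsD1 k A; rewrite cA kA => -[].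
  have a_injk : {in A :\ k &, forall i l, i != l ->
                   forall j, (j < n)%N -> a i j != a l j}.
    move=> i l /setD1P[_ iA] /setD1P[_ lA] il j jn; apply: a_inj => //.
    exact: leqW.
  have bg := boxpoly_sum (index_enum _)
    (fun (e : 'I_(n.+1 + 1)) (_ : true) => boxpolyZ (a k n ^+ e) (bu e)).
  have [h hE] := IHn (A :\ k) _ cAk a_injk bg.
  by exists h.
have {slice} [h hP] := fin_all_exists slice.
pose L k i : {poly K} := \prod_(l in A :\ k :\ i) ('X - (a l n)%:P).
pose w k := \prod_(l in A :\ k) (a k n - a l n).
have sL k i : k \in A -> i \in A :\ k -> (size (L k i) <= n.+1)%N.
  move=> kA iAk; rewrite size_prod_XsubC_set.
  by have := cardsD1 k A; rewrite cA kA (cardsD1 i (A :\ k)) iAk => -[->].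
have LE k i x : i \in A :\ k ->
    \prod_(l in A :\ k) (x n - a l n) = (x n - a i n) * (L k i).[x n].
  move=> iAk; rewrite horner_prod_XsubC (bigD1 i) //=; congr (_ * _).
  by apply: eq_bigl => l; rewrite !inE andbC.
have lagrange x : f x = \sum_(k in A) (w k)^-1 * (\sum_(i in A :\ k)
     h k i x * \prod_(j < n) (x j - a i j)) * \prod_(l in A :\ k) (x n - a l n).
  pose p := \poly_(e < n.+1 + 1) u e x.
  have an_inj : {in A &, injective (a^~ n)}.
    move=> i k iA kA aik; apply/eqP; apply: contraTT isT => ik.
    by have := a_inj i k iA kA ik n (ltnSn n); rewrite aik eqxx.
  have sp : (size p <= #|A|)%N by rewrite cA -[n.+2]addn1 size_poly.
  have -> : f x = p.[x n] by rewrite fu horner_poly.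
  rewrite (lagrange_interpolation _ an_inj sp); apply: eq_bigr => k kA.
  have [_ <-] := hP k kA; congr (_ * _ * _).
  by rewrite horner_poly; apply: eq_bigr => e _; rewrite mulrC.
exists (fun i x =>
  \sum_(k in A | i \in A :\ k) (w k)^-1 * (h k i x * (L k i).[x n])).
split=> [i|x].
  have b k : (k \in A) && (i \in A :\ k) -> boxpoly 0 n.+1
      (fun x => (w k)^-1 * (h k i x * (L k i).[x n])).
    move=> /andP[kA iAk]; have [bh _] := hP k kA.
    apply/boxpolyZ/(boxpoly_mul_last _ (bh i)).
    by rewrite addn0 sL.
  exact: boxpoly_sum b.
pose G i := \prod_(j < n) (x j - a i j).
transitivity (\sum_(k in A) \sum_(i in A :\ k) (w k)^-1 *
    (h k i x * (L k i).[x n]) * (G i * (x n - a i n))).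
  rewrite lagrange; apply: eq_bigr => k kA.
  rewrite -mulrA mulr_suml mulr_sumr; apply: eq_bigr => i iAk.
  by rewrite (LE _ _ _ iAk) -/(G i); move: (w k)^-1 => wk; ring.
rewrite (exchange_big_dep (mem A)) /=; last by move=> k i _ /setD1P[].
apply: eq_bigr => i iA; rewrite mulr_suml; apply: eq_bigr => k _.
by rewrite big_ord_recr.
Qed.

(** * Functions on the solution set of a system *)

Section System.
Variables (I J : finType) (a : I -> nat -> K) (pt : J -> nat -> K).

(** In the [i]-th summand write [x n = a i n + (x n - a i n)]: the first part stays in the box, and
    the second completes the product, which is the constant [b i] on solutions. Hence the equality
    only at points [pt v]. *)
Lemma boxpoly_mul_coord n (A : {set I}) (b : I -> K) (B : {set J}) f :
  #|A| = n.+1 ->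
  {in A &, forall i k, i != k -> forall j, (j < n)%N -> a i j != a k j} ->
  {in B & A, forall v i, \prod_(j < n.+1) (pt v j - a i j) = b i} ->
  boxpoly 1 n f ->
  exists2 g, boxpoly 1 n g & {in B, forall v, g (pt v) = f (pt v) * pt v n}.
Proof.
move=> cA a_inj sol bf.
have [h [bh fE]] := boxpoly_span_linear_products cA a_inj bf.
have bg i : i \in A -> boxpoly 1 n (fun x =>
    a i n * (h i x * \prod_(j < n) (x j - a i j)) + b i * h i x).
  move=> _; apply: boxpolyD; apply: boxpolyZ; first exact: boxpoly_mul_linear.
  exact: boxpoly_degS.
exists (fun x => \sum_(i in A)
  (a i n * (h i x * \prod_(j < n) (x j - a i j)) + b i * h i x)).
  exact: boxpoly_sum bg.
move=> v vB; rewrite fE mulr_suml; apply: eq_bigr => i iA.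
by rewrite -(sol v i vB iA) big_ord_recr /=; ring.
Qed.

(** On the slice sharing the last coordinate of [u], dividing by the nonzero last factors and
    dropping one equation leaves a smaller system, where induction separates [u]. A polynomial in
    the last coordinate then kills the other slices. *)
Lemma boxpoly_separates n (A : {set I}) (b : I -> K) (B : {set J}) u :
  #|A| = n.+1 ->
  {in A &, forall i k, i != k -> forall j, (j < n.+1)%N -> a i j != a k j} ->
  {in A, forall i, b i != 0} ->
  {in B & A, forall v i, \prod_(j < n.+1) (pt v j - a i j) = b i} ->
  {in B &, forall v w, (forall j, (j < n.+1)%N -> pt v j = pt w j) -> v = w} ->
  u \in B ->
  exists2 f, boxpoly 1 n f & {in B, forall v, f (pt v) = (v == u)%:R}.
Proof.
elim: n A b B => [|n IHn] A b B cA a_inj b_neq0 sol pt_inj uB.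
  exists (fun=> 1); first by exists 1.
  have /card_gt0P[i iA] : (0 < #|A|)%N by rewrite cA.
  move=> v vB; rewrite (_ : v = u) ?eqxx //; apply: pt_inj => // j.
  rewrite ltnS leqn0 => /eqP->; apply: (addIr (- a i 0)).
  by have := sol v i vB iA; rewrite -(sol u i uB iA) !big_ord1.
pose c := pt u n.+1.
have c_neq i : i \in A -> c - a i n.+1 != 0.
  move=> iA; have := b_neq0 i iA; rewrite -(sol u i uB iA) big_ord_recr /=.
  by rewrite mulf_eq0 negb_or => /andP[].
have /card_gt0P[k kA] : (0 < #|A|)%N by rewrite cA.
have sA : {subset A :\ k <= A} by move=> i /setD1P[].
pose Bc := [set v in B | pt v n.+1 == c].
have [f0 bf0 f0E] : exists2 f, boxpoly 1 n f &
    {in Bc, forall v, f (pt v) = (v == u)%:R}.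
  apply: (IHn (A :\ k) (fun i => b i / (c - a i n.+1))).
  - by have := cardsD1 k A; rewrite cA kA => -[].
  - by move=> i l /sA iA /sA lA il j jn; apply: a_inj => //; apply: leqW.
  - by move=> i /sA iA; rewrite mulf_neq0 ?invr_eq0 ?c_neq ?b_neq0.
  - move=> v i /setIdP[vB /eqP vc] /sA iA; rewrite -(sol v i vB iA).
    by rewrite [in RHS]big_ord_recr /= vc mulfK ?c_neq.
  - move=> v w /setIdP[vB /eqP vc] /setIdP[wB /eqP wc] vw.
    apply: pt_inj => // j.
    by rewrite ltnS leq_eqVlt => /predU1P[->|/vw//]; rewrite vc wc.
  - by rewrite inE uB eqxx.
(* Horner's scheme: each multiplication by the last coordinate is replaced by a box polynomial with
   the same values on [B]. *)
have mul_poly (p : {poly K}) : exists2 f, boxpoly 1 n.+1 f &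
    {in B, forall v, f (pt v) = f0 (pt v) * p.[pt v n.+1]}.
  elim/poly_ind: p => [|p e [f bf fE]].
    exists (fun=> 0); first exact: boxpoly_const.
    by move=> v _; rewrite horner0 mulr0.
  have a_inj' : {in A &, forall i k, i != k ->
      forall j, (j < n.+1)%N -> a i j != a k j}.
    by move=> i l iA lA il j jn; apply: a_inj => //; apply: leqW.
  have [g bg gE] := boxpoly_mul_coord cA a_inj' sol bf.
  exists (fun x => g x + e * f0 x).
    by apply/boxpolyD/boxpolyZ/boxpoly_lift.
  move=> v vB; rewrite gE // fE // hornerD hornerM hornerX hornerC; ring.
pose p := \prod_(v in B :\: Bc) ('X - (pt v n.+1)%:P).
have [f bf fE] := mul_poly (p.[c]^-1 *: p); exists f => // v vB.
rewrite fE // hornerZ; have [vBc|vBc] := boolP (v \in Bc).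
  rewrite f0E //; move: vBc; rewrite !inE => /andP[_ /eqP->].
  rewrite mulVf ?mulr1 // horner_prod_XsubC; apply/prodf_neq0 => w.
  by rewrite !inE => /andP[+ wB]; rewrite wB subr_eq0 eq_sym.
have -> : p.[pt v n.+1] = 0.
  have vD : v \in B :\: Bc by rewrite in_setD vBc.
  by rewrite horner_prod_XsubC (bigD1 v vD) /= subrr mul0r.
rewrite !mulr0; case: eqP => // vu.
by rewrite !inE vu uB eqxx in vBc.
Qed.

(* The lemma of Kollar, Ronyai and Szabo, for nonzero right-hand sides. *)
Lemma card_solutions_le n (A : {set I}) (b : I -> K) (B : {set J}) :
  #|A| = n.+1 ->
  {in A &, forall i k, i != k -> forall j, (j < n.+1)%N -> a i j != a k j} ->
  {in A, forall i, b i != 0} ->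
  {in B & A, forall v i, \prod_(j < n.+1) (pt v j - a i j) = b i} ->
  {in B &, forall v w, (forall j, (j < n.+1)%N -> pt v j = pt w j) -> v = w} ->
  (#|B| <= (n.+1)`!)%N.
Proof.
move=> cA a_inj b_neq0 sol pt_inj.
have [M [mon [cM span]]] := boxpoly_span 1 n.
have coords (v : {v | v \in B}) : exists c : M -> K,
    {in B, forall w, \sum_i c i * mon i (pt w) = (w == val v)%:R}.
  have [f bf fE] := boxpoly_separates cA a_inj b_neq0 sol pt_inj (valP v).
  by have [c cE] := span f bf; exists c => w wB; rewrite -cE fE.
have [c cE] := fin_all_exists coords.
have <- : #|M| = (n.+1)`!.
  rewrite cM fact_prod big_add1 /= big_mkord big_ord_recl mul1n.
  by apply: eq_bigr => j _; rewrite addn1.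
rewrite -card_sig.
(* [P *m Q] is the identity of size [#|B|], factored through dimension [#|M|]. *)
pose P := \matrix_(i < #|{: {v | v \in B}}|, j < #|M|)
  c (enum_val i) (enum_val j).
pose Q := \matrix_(j < #|M|, i < #|{: {v | v \in B}}|)
  mon (enum_val j) (pt (val (enum_val i))).
apply: (@mulmx1_min K _ _ P Q); apply/matrixP => i k; rewrite !mxE.
rewrite -(inj_eq enum_val_inj) eq_sym -val_eqE -cE ?(valP (enum_val k)) //.
rewrite (reindex (@enum_val M predT)) /=.
  by apply: eq_bigr => j _; rewrite !mxE.
by exists enum_rank => j _; rewrite ?enum_valK ?enum_rankK.
Qed.
End System.
End BoxPolynomials.

(** * Common neighbours in the norm graph *)

Section NormGraph.
Variables (F : finFieldType) (q d n m : nat) (w : F).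
Hypotheses (q_char : [pchar F].-nat q) (d_gt0 : (0 < d)%N).
Hypothesis w_prim : m.-primitive_root w.

(** In the application [F] has degree [n.+1] over the field with [q] elements and t is [n.+2]: the n
    of the overview is [n.+1] here. *)
Let e := (d * \sum_(j < n.+1) q ^ j)%N.

Let e_gt0 : (0 < e)%N.
Proof. by rewrite muln_gt0 d_gt0 big_ord_recl. Qed.

Lemma pchar_nat_exp j : [pchar F].-nat (q ^ j)%N.
Proof. by rewrite pnatX q_char. Qed.

(** Powers by [q ^ j] are additive; the double sign matches the shape [x j - a i j] of the systems
    above. *)
Lemma prod_pchar_powers (x y : F) :
  \prod_(j < n.+1) (x ^+ (q ^ j) - - y ^+ (q ^ j)) =
  (x + y) ^+ (\sum_(j < n.+1) q ^ j).
Proof.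
rewrite expr_sum; apply: eq_bigr => j _.
by rewrite opprK exprDn_pchar ?pchar_nat_exp.
Qed.

Lemma expX_pchar_inj j : injective (fun x : F => x ^+ (q ^ j)).
Proof.
move=> x y /= xy; apply/eqP; rewrite -subr_eq0.
have: (x - y) ^+ (q ^ j) == 0.
  apply/eqP/(addIr (y ^+ (q ^ j))).
  by rewrite -exprDn_pchar ?pchar_nat_exp // subrK add0r.
by rewrite expf_eq0 => /andP[].
Qed.

Lemma card_power_roots_le (b : F) : (#|[set y : F | y ^+ d == b]| <= d)%N.
Proof.
have nz : 'X^d - b%:P != 0 :> {poly F}.
  by rewrite -size_poly_eq0 size_XnsubC.
rewrite -ltnS -(size_XnsubC b d_gt0) cardE.
apply: max_poly_roots nz _ (enum_uniq _); apply/allP => y.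
by rewrite mem_enum inE rootE !hornerE subr_eq0.
Qed.

(** Dividing the equations by that of the base vertex [P ord0] cancels [w ^+ v.2]. So each [N v i]
    is a [d]-th root of a constant [beta i], and each choice of these roots gives a system with at
    most (n + 1)! solutions. *)
Lemma card_common_neighbours_le (P : 'I_n.+2 -> F * 'I_m)
    (B : {set F * 'I_m}) :
  injective P ->
  (forall i v, v \in B -> ((P i).1 - v.1) ^+ e = w ^+ ((P i).2 + v.2)) ->
  (#|B| <= (n.+1)`! * d ^ n.+1)%N.
Proof.
move=> P_inj PB.
have [->|[v0 v0B]] := set_0Vmem B; first by rewrite cards0.
have w_neq0 : w != 0.
  have := prim_order_gt0 w_prim; apply: contraTneq => w0.
  apply/negP => m_gt0; have := prim_expr_order w_prim.
  by rewrite w0 expr0n gtn_eqF // => /eqP; rewrite eq_sym oner_eq0.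
have P_neq i v : v \in B -> (P i).1 - v.1 != 0.
  move=> vB; have: ((P i).1 - v.1) ^+ e != 0 by rewrite PB // expf_neq0.
  by rewrite expf_eq0 e_gt0.
have ord_inj (x y : 'I_m) : w ^+ x = w ^+ y -> x = y.
  move=> /eqP; rewrite (eq_prim_root_expr w_prim) !modn_small // => /eqP.
  exact: val_inj.
(* At the common neighbour [v0], equal first coordinates force equal powers of [w]; this is why [B]
   is first taken nonempty. *)
have P1_inj i k : (P i).1 = (P k).1 -> i = k.
  move=> ik; apply: P_inj.
  rewrite [LHS]surjective_pairing [RHS]surjective_pairing -ik.
  congr (_, _); apply: ord_inj.
  apply: (mulIf (expf_neq0 v0.2 w_neq0)); rewrite -!exprD -!PB //.
  by rewrite ik.
pose z (v : F * 'I_m) := ((P ord0).1 - v.1)^-1.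
pose D i := (P (lift ord0 i)).1 - (P ord0).1.
have D_neq0 i : D i != 0.
  by rewrite subr_eq0; apply: contra_eqN (eqxx true) => /eqP/P1_inj.
pose N v i := (z v + (D i)^-1) ^+ (\sum_(j < n.+1) q ^ j).
pose beta i := w ^+ (P (lift ord0 i)).2 / (w ^+ (P ord0).2 * D i ^+ e).
have NB v i : v \in B -> N v i ^+ d = beta i.
  move=> vB; rewrite -exprM mulnC -/e.
  have -> : z v + (D i)^-1 = ((P (lift ord0 i)).1 - v.1) /
                             (((P ord0).1 - v.1) * D i).
    rewrite /z; move: (D_neq0 i) (P_neq ord0 v vB); rewrite /D => Di Pv.
    by field; rewrite Di Pv.
  rewrite expr_div_n exprMn !(PB _ _ vB) /beta !exprD.
  have := expf_neq0 v.2 w_neq0; have := expf_neq0 (P ord0).2 w_neq0.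
  have := expf_neq0 e (D_neq0 i) => ? ? ?.
  by field; apply/and3P.
have beta_neq0 i : beta i != 0.
  by rewrite mulf_neq0 ?invr_eq0 ?mulf_neq0 ?expf_neq0.
pose Nf v := [ffun i => N v i].
pose S := family (fun i => [set y : F | y ^+ d == beta i]).
have NS v : v \in B -> Nf v \in S.
  by move=> vB; apply/familyP => i; rewrite ffunE inE NB.
have fibre b : b \in S -> (\sum_(v in B | Nf v == b) 1 <= (n.+1)`!)%N.
  move=> /familyP bS; rewrite sum1dep_card.
  apply: (@card_solutions_le F _ _ (fun i j => - (D i)^-1 ^+ (q ^ j))
    (fun v j => z v ^+ (q ^ j)) n [set: 'I_n.+1] b).
  - by rewrite cardsT card_ord.
  - move=> i k _ _ ik j _; rewrite eqr_opp; apply: contra ik.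
    by move=> /eqP/expX_pchar_inj/invr_inj/addIr/P1_inj/lift_inj->.
  - move=> i _; have := bS i; rewrite inE => /eqP bE.
    by apply: contraNneq (beta_neq0 i) => b0; rewrite -bE b0 expr0n gtn_eqF.
  - move=> v i; rewrite inE => /andP[_ /eqP<-] _.
    by rewrite prod_pchar_powers ffunE.
  (* Coordinate 0 is [z v] itself and gives [v.1]; the equation of [P ord0] then gives [v.2]. *)
  - move=> u v; rewrite !inE => /andP[uB _] /andP[vB _] /(_ 0 isT).
    rewrite expn0 !expr1 => /invr_inj/addrI/oppr_inj uv.
    rewrite [LHS]surjective_pairing [RHS]surjective_pairing -uv; congr (_, _).
    apply: ord_inj; apply: (mulfI (expf_neq0 (P ord0).2 w_neq0)).
    by rewrite -!exprD -!PB // uv.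
rewrite -sum1_card (partition_big Nf (mem S)) //=.
apply: (@leq_trans (\sum_(b in S) (n.+1)`!)).
  by apply: leq_sum => b; apply: fibre.
rewrite sum_nat_const mulnC leq_mul2l card_family foldrE big_image /=.
apply/orP; right; rewrite -[in X in (_ <= X)%N](card_ord n.+1) -prod_nat_const.
by apply: leq_prod => i _; apply: card_power_roots_le.
Qed.
End NormGraph.

(** * Graph constructions *)

Section Bipartite.
Variables (P Q : finType) (e : P -> Q -> bool).

Definition bip_adj : rel (P + Q) := fun x y =>
  match x, y with
  | inl u, inr v | inr v, inl u => e u v
  | _, _ => false
  end.

Lemma bip_sym : symmetric bip_adj. Proof. by case=> x []. Qed.

Lemma bip_irr : irreflexive bip_adj. Proof. by case. Qed.

Definition bip : sgraph := SGraph bip_sym bip_irr.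

(** The complete bipartite graph is connected, so its sides map to the two sides of [bip]; each
    hypothesis excludes one orientation. *)
Lemma bip_free s t : (0 < s)%N -> (0 < t)%N ->
  (forall (u : 'I_s -> P) (v : 'I_t -> Q), injective u -> injective v ->
     ~ forall i j, e (u i) (v j)) ->
  (forall (u : 'I_s -> Q) (v : 'I_t -> P), injective u -> injective v ->
     ~ forall i j, e (v j) (u i)) ->
  is_free (Kbip s t) bip.
Proof.
move=> s_gt0 t_gt0 noPQ noQP [phi [phi_inj phi_adj]].
pose f i : P + Q := phi (inl i); pose g j : P + Q := phi (inr j).
have fg i j : bip_adj (f i) (g j) := phi_adj (inl i) (inr j) isT.
have f_inj : injective f by move=> i k /phi_inj[].
have g_inj : injective g by move=> i k /phi_inj[].
clearbody f g; clear phi phi_inj phi_adj.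
case E0: (g (Ordinal t_gt0)) => [x0|y0].
- have /fin_all_exists[u fu] (i : 'I_s) : exists x : Q, f i = inr x.
    have := fg i (Ordinal t_gt0); rewrite E0.
    by case: (f i) => // y _; exists y.
  have /fin_all_exists[v gv] (j : 'I_t) : exists x : P, g j = inl x.
    have := fg (Ordinal s_gt0) j; rewrite fu.
    by case: (g j) => // x _; exists x.
  case: (noQP u v) => [i k uik|j l vjl|i j].
  + by apply: f_inj; rewrite !fu uik.
  + by apply: g_inj; rewrite !gv vjl.
  + by have := fg i j; rewrite fu gv.
- have /fin_all_exists[u fu] (i : 'I_s) : exists x : P, f i = inl x.
    have := fg i (Ordinal t_gt0); rewrite E0.
    by case: (f i) => // x _; exists x.
  have /fin_all_exists[v gv] (j : 'I_t) : exists x : Q, g j = inr x.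
    have := fg (Ordinal s_gt0) j; rewrite fu.
    by case: (g j) => // y _; exists y.
  case: (noPQ u v) => [i k uik|j l vjl|i j].
  + by apply: f_inj; rewrite !fu uik.
  + by apply: g_inj; rewrite !gv vjl.
  + by have := fg i j; rewrite fu gv.
Qed.
End Bipartite.

Section Unions.
Variables (T : finType) (G1 G2 : sgraph).

Definition union_copies_adj : rel (G1 + T * G2) := fun x y =>
  match x, y with
  | inl u, inl v => adj u v
  | inr u, inr v => (u.1 == v.1) && adj u.2 v.2
  | _, _ => false
  end.

Lemma union_copies_sym : symmetric union_copies_adj.
Proof.
case=> [u|[b u]] [v|[c v]] //=; first by rewrite adj_sym.
by rewrite eq_sym adj_sym.
Qed.

Lemma union_copies_irr : irreflexive union_copies_adj.
Proof. by case=> [u|[b u]] /=; rewrite ?adj_irr ?andbF. Qed.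

Definition union_copies : sgraph := SGraph union_copies_sym union_copies_irr.

(** By connectedness, the image of the complete bipartite graph lies in [G1] or in a single copy of
    [G2]. *)
Lemma union_copies_free s t : (0 < s)%N -> (0 < t)%N ->
  is_free (Kbip s t) G1 -> is_free (Kbip s t) G2 ->
  is_free (Kbip s t) union_copies.
Proof.
move=> s_gt0 t_gt0 free1 free2 [phi [phi_inj phi_adj]].
pose comp (x : G1 + T * G2) := if x is inr u then Some u.1 else None.
have comp_adj x y : union_copies_adj x y -> comp x = comp y.
  by case: x y => [u|u] [v|v] //= /andP[/eqP->].
have compE x : comp (phi x) = comp (phi (inr (Ordinal t_gt0))).
  have fg i j : comp (phi (inl i)) = comp (phi (inr j)).
    by apply: comp_adj; apply: (phi_adj (inl i) (inr j)).
  by case: x => [i|j]; [|rewrite -(fg (Ordinal s_gt0))]; apply: fg.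
case Ec: (comp (phi (inr (Ordinal t_gt0)))) => [c|].
- have /fin_all_exists[psi psiE] x : exists u : G2, phi x = inr (c, u).
    have := compE x; rewrite Ec.
    by case: (phi x) => // -[b u] [->]; exists u.
  apply: free2; exists psi; split=> [x y xy|x y xy].
    by apply: phi_inj; rewrite !psiE xy.
  by have := phi_adj x y xy; rewrite !psiE /= eqxx.
- have /fin_all_exists[psi psiE] x : exists u : G1, phi x = inl u.
    have := compE x; rewrite Ec.
    by case: (phi x) => // u _; exists u.
  apply: free1; exists psi; split=> [x y xy|x y xy].
    by apply: phi_inj; rewrite !psiE xy.
  by have := phi_adj x y xy; rewrite !psiE.
Qed.
End Unions.

Lemma Kbip_free_mono s t s' t' G : (s <= s')%N -> (t <= t')%N ->
  is_free (Kbip s t) G -> is_free (Kbip s' t') G.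
Proof.
move=> ss' tt' free [phi [phi_inj phi_adj]]; apply: free.
pose emb (x : Kbip s t) : Kbip s' t' :=
  match x with
  | inl i => inl (widen_ord ss' i)
  | inr j => inr (widen_ord tt' j)
  end.
exists (phi \o emb); split=> [x y /= /phi_inj|x y xy].
  by case: x y => i [] j //= [/val_inj->].
by apply: phi_adj; case: x y xy => i [].
Qed.

(** Encoding a partition by its label function makes covering and disjointness automatic. *)
Definition rk_labelling (T : finType) (k : nat) (G : sgraph) (lab : G -> T) :=
  (forall i, (#|[set x | lab x == i]| <= k)%N) /\
  (forall i j, i != j -> exists x y, [/\ lab x = i, lab y = j & adj x y]).

Lemma rk_labelling_rk (T : finType) k (G : sgraph) (lab : G -> T) :
  rk_labelling k lab -> is_rk_graph #|T| k G.
Proof.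
case=> lab_k lab_adj; exists (fun i => [set x | lab x == enum_val i]); split.
- apply/setP => x; rewrite in_setT; apply/bigcupP.
  by exists (enum_rank (lab x)); rewrite // inE enum_rankK.
- move=> i j ij; apply/pred0P => x /=; rewrite !inE.
  by apply: contraNF ij => /andP[/eqP-> /eqP/enum_val_inj->].
- by move=> i; apply: lab_k.
- move=> i j ij; have [|x [y [xi yj xy]]] := lab_adj (enum_val i) (enum_val j).
    by rewrite (inj_eq enum_val_inj).
  by exists x, y; rewrite !inE xi yj !eqxx.
Qed.

Lemma card_set_sum (A B : finType) (p : pred (A + B)) :
  #|[set x | p x]| = (#|[set x | p (inl x)]| + #|[set y | p (inr y)]|)%N.
Proof. by rewrite -!sum1dep_card big_sumType. Qed.

Lemma card_set_prod (A B : finType) (a : A) (p : pred B) :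
  #|[set x : A * B | (x.1 == a) && p x.2]| = #|[set y | p y]|.
Proof.
rewrite -[RHS]mul1n -(cards1 a) -cardsX; apply: eq_card => x.
by rewrite !inE.
Qed.

Lemma card_fst_fibre (A B : finType) (a : A) :
  #|[set x : A * B | x.1 == a]| = #|B|.
Proof.
rewrite -[RHS]cardsT -(card_set_prod a xpredT); apply: eq_card => x.
by rewrite !inE andbT.
Qed.

(** * A C4-free graph with small parts, from points and lines *)

(* The point [p] lies on the line [l] iff [p.2 + l.2 = p.1 * l.1]. *)
Lemma incidence_unique (F : idomainType) (p p' l l' : F * F) :
  p.2 + l.2 = p.1 * l.1 -> p.2 + l'.2 = p.1 * l'.1 ->
  p'.2 + l.2 = p'.1 * l.1 -> p'.2 + l'.2 = p'.1 * l'.1 ->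
  p = p' \/ l = l'.
Proof.
case: p p' l l' => [x y] [x' y'] [m b] [m' b'] /= e1 e2 e3 e4.
have /eqP : (x - x') * (m - m') = 0.
  by rewrite mulrBl !mulrBr -e1 -e2 -e3 -e4; ring.
rewrite mulf_eq0 !subr_eq0 => /orP[]/eqP xx; [left|right]; rewrite xx.
  by congr (_, _); apply: (addIr b); rewrite e1 e3 xx.
by congr (_, _); apply: (addrI y); rewrite e1 e2 xx.
Qed.

(** The additive group of the field of order 4^k is a 2-group, so it has a subgroup of order 2^k:
    [u] lists this subgroup and [v] representatives of its cosets. *)
Lemma exists_tiled_field k : (0 < k)%N ->
  exists (F : finFieldType) (u v : 'I_(2 ^ k) -> F),
    #|F| = (2 ^ k * 2 ^ k)%N /\ forall z, exists i j, z = u i + v j.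
Proof.
move=> k_gt0; have kk_gt0 : (0 < k + k)%N by rewrite addn_gt0 k_gt0.
have [F charF cF] := @pPrimePowerField 2 (k + k) isT kk_gt0.
have pF : (2.-group [set: F])%g by apply/abelem_pgroup/fin_ring_pchar_abelem.
have [] := normal_pgroup (r := k) pF (normal_refl _).
  by rewrite cardsT cF pfactorK // leq_addr.
move=> H [sHF _ cH].
have cR : #|rcosets H [set: F]| = (2 ^ k)%N.
  apply/eqP; rewrite -(eqn_pmul2l (expn_gt0 2 k)) -{1}cH -expnD -cF -cardsT.
  by rewrite Lagrange.
pose u (i : 'I_(2 ^ k)) : F := enum_val (cast_ord (esym cH) i).
pose v (j : 'I_(2 ^ k)) : F := repr (enum_val (cast_ord (esym cR) j)).
exists F, u, v; split=> [|z]; first by rewrite cF expnD.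
have Hz : (H :* z)%g \in rcosets H [set: F].
  by apply/rcosetsP; exists z; rewrite ?inE.
pose r := repr (H :* z)%g.
have zr : z - r \in H.
  have : (z \in H :* r)%g by rewrite rcoset_repr rcoset_refl.
  by rewrite mem_rcoset.
exists (cast_ord cH (enum_rank_in zr (z - r))).
exists (cast_ord cR (enum_rank_in Hz (H :* z)%g)).
by rewrite /u /v !cast_ordK !enum_rankK_in // subrK.
Qed.

Section IncidenceGraph.
Variables (F : finFieldType) (Q a : nat) (u v : 'I_Q -> F).
Hypotheses (cF : #|F| = (Q * Q)%N) (tile : forall z, exists i j, z = u i + v j).
Variables (c : 'I_a -> F * 'I_Q).
Hypothesis c_inj : injective c.

Lemma tile_inj i j i' j' : u i + v j = u i' + v j' -> i = i' /\ j = j'.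
Proof.
have /fin_all_exists[g gE] z : exists k : 'I_Q * 'I_Q, u k.1 + v k.2 = z.
  have [k [l ->]] := tile z.
  by exists (k, l).
have g_bij : bijective g.
  apply: inj_card_bij; last by rewrite card_prod card_ord cF.
  by move=> x y xy; rewrite -(gE x) -(gE y) xy.
case: (g_bij) => f gf fg ij.
have fE k l : u k + v l = f (k, l) by rewrite -(gE (f (k, l))) fg.
move: ij; rewrite !fE => /(can_inj fg) [-> ->]; by [].
Qed.

(** Label [i] gets points of abscissa [(c i).1] with ordinate in a translate of the image of [u],
    and lines of slope [(c i).1] with second coordinate in a translate of the image of [v]. Sums of
    the two cover [F], so any two labels are joined. *)
Definition point (x : 'I_a * 'I_Q) : F * F := ((c x.1).1, u x.2 + v (c x.1).2).
Definition line (x : 'I_a * 'I_Q) : F * F := ((c x.1).1, u (c x.1).2 + v x.2).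

Lemma point_inj : injective point.
Proof.
move=> [i k] [i' k'] [ci /tile_inj[/= -> cj]]; congr (_, _); apply: c_inj.
by rewrite [LHS]surjective_pairing [RHS]surjective_pairing ci cj.
Qed.

Lemma line_inj : injective line.
Proof.
move=> [i k] [i' k'] [ci /tile_inj[/= cj ->]]; congr (_, _); apply: c_inj.
by rewrite [LHS]surjective_pairing [RHS]surjective_pairing ci cj.
Qed.

Definition incidence (x y : 'I_a * 'I_Q) :=
  (point x).2 + (line y).2 == (point x).1 * (line y).1.

Lemma incidence_C4_free : is_free (Kbip 2 2) (bip incidence).
Proof.
apply: bip_free => // f g f_inj g_inj fg.
- have := @incidence_unique F (point (f ord0)) (point (f ord_max))
            (line (g ord0)) (line (g ord_max)).
  rewrite !(eqP (fg _ _)) => /(_ erefl erefl erefl erefl).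
  by case=> [/point_inj/f_inj|/line_inj/g_inj].
- have := @incidence_unique F (point (g ord0)) (point (g ord_max))
            (line (f ord0)) (line (f ord_max)).
  rewrite !(eqP (fg _ _)) => /(_ erefl erefl erefl erefl).
  by case=> [/point_inj/g_inj|/line_inj/f_inj].
Qed.

Definition incidence_label (x : bip incidence) : 'I_a :=
  match x with inl y | inr y => y.1 end.

Lemma incidence_labelling : rk_labelling (Q + Q) incidence_label.
Proof.
split=> [i|i j _].
  rewrite (card_set_sum (fun x => incidence_label x == i)) /=.
  by rewrite !card_fst_fibre card_ord.
have [k [l kl]] := tile ((c i).1 * (c j).1 - (v (c i).2 + u (c j).2)).
exists (inl (i, k)), (inr (j, l)); split=> //; rewrite /= /incidence /=.
apply/eqP; apply: (addIr (- (v (c i).2 + u (c j).2))); rewrite kl; ring.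
Qed.
End IncidenceGraph.

(** Labels are embedded into pairs of a field element and an index, of which there are 4^k * 2^k =
    8^k. *)
Lemma exists_C4_free_labelling a k : (0 < k)%N -> (a <= 8 ^ k)%N ->
  exists (G : sgraph) (lab : G -> 'I_a),
    rk_labelling (2 * 2 ^ k) lab /\ is_free (Kbip 2 2) G.
Proof.
move=> k_gt0 ak; have [F [u [v [cF tile]]]] := exists_tiled_field k_gt0.
have a_le : (a <= #|{: F * 'I_(2 ^ k)}|)%N.
  rewrite card_prod card_ord cF -!expnD (leq_trans ak) //.
  by rewrite -[8%N]/(2 ^ 3)%N -expnM leq_exp2l //; lia.
pose c i : F * 'I_(2 ^ k) := enum_val (widen_ord a_le i).
have c_inj : injective c by move=> i j /enum_val_inj [/val_inj].
exists (bip (incidence u v c)), (@incidence_label _ _ _ u v c); split.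
  by rewrite mul2n -addnn; apply: incidence_labelling.
exact: incidence_C4_free.
Qed.

(** * The partitioned norm graph *)

Section PartitionedNormGraph.
Variables (F : finFieldType) (q d n h a : nat) (w : F).
Hypotheses (q_char : [pchar F].-nat q) (d_gt0 : (0 < d)%N).
Hypotheses (a_gt0 : (0 < a)%N) (a_le_h : (a <= h)%N).
Hypothesis w_prim : (h * a).-primitive_root w.

Let e := (d * \sum_(j < n.+1) q ^ j)%N.

(** This holds once [#|F| = q ^ n.+1] and [d * (h * a) = q.-1], as the exponent is then
    [#|F|.-1]. *)
Hypothesis unit_exp : forall z : F, z != 0 -> z ^+ (e * (h * a)) = 1.

Lemma residue_lt (i : 'I_a) (k : 'I_h) : (k * a + i < h * a)%N.
Proof. by rewrite -ltn_divLR // divnMDl // divn_small // addn0. Qed.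

Lemma block_lt (i l : 'I_a) : (i * a + l < h * a)%N.
Proof.
by rewrite -ltn_divLR // divnMDl // divn_small // addn0 (leq_trans _ a_le_h).
Qed.

Lemma divmod_inj b i i' l l' :
  (i < b)%N -> (i' < b)%N -> (l * b + i = l' * b + i')%N -> i = i' /\ l = l'.
Proof.
move=> ib i'b E; have b_gt0 := leq_ltn_trans (leq0n i) ib; split.
  by have := congr1 (modn^~ b) E; rewrite !modnMDl !modn_small.
by have := congr1 (divn^~ b) E; rewrite !divnMDl // !divn_small // !addn0.
Qed.

Definition left_vertex (x : F * 'I_a * 'I_h) : F * 'I_(h * a) :=
  (x.1.1, Ordinal (residue_lt x.1.2 x.2)).

Definition right_vertex (x : F * 'I_a * 'I_a) : F * 'I_(h * a) :=
  (x.1.1, Ordinal (block_lt x.1.2 x.2)).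

Lemma left_vertex_inj : injective left_vertex.
Proof.
move=> [[A i] k] [[A' i'] k'] [/= -> /divmod_inj[]] //.
by move=> /val_inj-> /val_inj->.
Qed.

Lemma right_vertex_inj : injective right_vertex.
Proof.
move=> [[A i] k] [[A' i'] k'] [/= -> /divmod_inj[]] //.
by move=> /val_inj-> /val_inj->.
Qed.

Definition norm_incidence (x : F * 'I_a * 'I_h) (y : F * 'I_a * 'I_a) :=
  ((left_vertex x).1 - (right_vertex y).1) ^+ e ==
  w ^+ ((left_vertex x).2 + (right_vertex y).2).

Lemma norm_incidence_free :
  is_free (Kbip n.+2 ((n.+1)`! * d ^ n.+1 + 1)) (bip norm_incidence).
Proof.
rewrite addn1; apply: bip_free => // f g f_inj g_inj fg.
- pose B := [set right_vertex (g j) | j in setT].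
  have := @card_common_neighbours_le F q d n (h * a) w q_char d_gt0 w_prim
           (left_vertex \o f) B (inj_comp left_vertex_inj f_inj).
  rewrite card_imset ?cardsT ?card_ord ?ltnn;
    last exact: inj_comp right_vertex_inj g_inj.
  move=> noB; suff: false by [].
  apply: noB => i _ /imsetP[j _ ->].
  exact/eqP/fg.
(* In the opposite orientation, A - B = (- B) - (- A): negating first coordinates swaps the roles,
   and the same bound applies. *)
- pose neg (x : F * 'I_(h * a)) := (- x.1, x.2).
  have neg_inj : injective neg by move=> [x i] [y j] [/oppr_inj-> ->].
  pose B := [set neg (left_vertex (g j)) | j in setT].
  have := @card_common_neighbours_le F q d n (h * a) w q_char d_gt0 w_prim
           (neg \o (right_vertex \o f)) B
           (inj_comp neg_inj (inj_comp right_vertex_inj f_inj)).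
  rewrite card_imset ?cardsT ?card_ord ?ltnn;
    last exact: inj_comp neg_inj (inj_comp left_vertex_inj g_inj).
  move=> noB; suff: false by [].
  apply: noB => i _ /imsetP[j _ ->].
  rewrite -[LHS]/((- _ - - _) ^+ e) opprK addrC addnC.
  exact/eqP/fg.
Qed.

Lemma norm_incidence_edge (A B : F) (i j : 'I_a) : A != B ->
  exists k l, norm_incidence (A, i, k) (B, j, l).
Proof.
rewrite -subr_eq0 => /unit_exp; rewrite exprM => /(prim_rootP w_prim)[r rE].
have m_gt0 := prim_order_gt0 w_prim.
have ij_lt : (i + j * a < h * a)%N by rewrite addnC block_lt.
(* The residue of [r - (i + j * a)]; its quotient by [a] selects the left vertex and its remainder
   the right one. *)
pose s := ((r + (h * a - (i + j * a))) %% (h * a))%N.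
have s_lt : (s < h * a)%N by rewrite ltn_mod.
have k_lt : (s %/ a < h)%N by rewrite ltn_divLR.
have l_lt : (s %% a < a)%N by rewrite ltn_mod.
exists (Ordinal k_lt), (Ordinal l_lt); rewrite /norm_incidence /= rE.
rewrite (eq_prim_root_expr w_prim).
have -> : (s %/ a * a + i + (j * a + s %% a) = (i + j * a) + s)%N.
  by rewrite [(_ + i)%N]addnC addnACA -divn_eq.
rewrite modnDmr addnCA subnKC ?modnDr //; exact: ltnW.
Qed.

Section WithFillerGraph.
Variables (b : nat) (G2 : sgraph) (lab2 : G2 -> 'I_a).
Hypothesis lab2_rk : rk_labelling b lab2.

Definition norm_graph := union_copies F (bip norm_incidence) G2.

Definition norm_label (x : norm_graph) : F * 'I_a :=
  match x with
  | inl (inl y) => y.1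
  | inl (inr y) => y.1
  | inr y => (y.1, lab2 y.2)
  end.

Lemma norm_labelling : rk_labelling (h + a + b) norm_label.
Proof.
case: lab2_rk => lab2_b lab2_adj; split=> [[A i]|[A i] [B j]].
  rewrite (card_set_sum (fun x => norm_label x == (A, i))) leq_add //.
    rewrite (card_set_sum (fun x => norm_label (inl x) == (A, i))) /=.
    by rewrite !card_fst_fibre !card_ord.
  apply: leq_trans (lab2_b i).
  by rewrite -(card_set_prod A (fun y => lab2 y == i)) /=.
have [<-|AB _] := eqVneq A B.
  rewrite xpair_eqE eqxx /= => /lab2_adj[x [y [xi yj xy]]].
  by exists (inr (A, x)), (inr (A, y)); rewrite /= xi yj eqxx.
have [k [l kl]] := norm_incidence_edge i j AB.
by exists (inl (inl (A, i, k))), (inl (inr (B, j, l))).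
Qed.
End WithFillerGraph.
End PartitionedNormGraph.

(** * Finite fields, numerical bounds and assembly *)

Lemma finfield_expf_predn (F : finFieldType) (z : F) :
  z != 0 -> z ^+ #|F|.-1 = 1.
Proof.
move=> z_neq0; apply: (mulfI z_neq0); rewrite -exprS mulr1 prednK ?expf_card //.
by apply/card_gt0P; exists z.
Qed.

Lemma finfield_prim_root (F : finFieldType) m :
  (m %| #|F|.-1)%N -> exists w : F, m.-primitive_root w.
Proof.
move=> mF; have F_gt1 : (0 < #|F|.-1)%N.
  by rewrite -subn1 subn_gt0 finNzRing_gt1.
pose rs := enum (predC1 (0 : F)).
have rs1 : all #|F|.-1.-unity_root rs.
  apply/allP => z; rewrite mem_enum inE => z_neq0.
  by apply/unity_rootP/finfield_expf_predn.
have s_rs : (#|F|.-1 <= size rs)%N by rewrite -cardE cardC1.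
have /hasP[w _ w_prim] := has_prim_root F_gt1 rs1 (enum_uniq _) s_rs.
by exists (w ^+ (#|F|.-1 %/ m)); apply: dvdn_prim_root.
Qed.

(** A least value exists by well-ordering, membership being decided classically. *)
Lemma f_is_le r H k :
  has_free_rk_graph r H k -> exists2 k', f_is r H k' & (k' <= k)%N.
Proof.
move=> Hk; have exk : exists k', `[< has_free_rk_graph r H k' >].
  by exists k; apply/asboolP.
case: (ex_minnP exk) => k' /asboolP Hk' k'_min; exists k'.
  by split=> // l Hl; apply: k'_min; apply/asboolP.
by apply: k'_min; apply/asboolP.
Qed.

(** Compare fifth powers: (2^k)^5 <= (8^k)^2 <= 64 h^2 <= 4^5 h^2. *)
Lemma pow_le_powR (R : realType) k h :
  (0 < h)%N -> (8 ^ k <= 8 * h)%N ->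
  (2 ^ k)%:R <= 4 * (h%:R `^ (2 / 5)) :> R.
Proof.
move=> h_gt0 kh; have y_ge0 : 0 <= h%:R `^ (2 / 5) :> R by apply: powR_ge0.
rewrite -(@ler_pXn2r R 5) ?nnegrE ?mulr_ge0 ?ler0n //.
have -> : (4 * h%:R `^ (2 / 5)) ^+ 5 = (1024 * h ^ 2)%:R :> R.
  rewrite exprMn -(powR_mulrn 5 y_ge0) -powRrM divfK ?pnatr_eq0 //.
  by rewrite powR_mulrn ?ler0n // natrM !natrX -[1024%N]/(4 ^ 5)%N natrX.
rewrite -natrX ler_nat -expnM.
apply: (@leq_trans ((8 ^ k) ^ 2)).
  by rewrite -[8%N]/(2 ^ 3)%N -!expnM leq_exp2l //; lia.
by rewrite (leq_trans (leq_mul kh kh)) //; lia.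
Qed.

Lemma free_rk_graph_exists (p m q d n h a k : nat) :
  prime p -> (0 < m)%N -> q = (p ^ m)%N -> (0 < d)%N ->
  (0 < a)%N -> (a <= h)%N -> (d * (h * a) = q.-1)%N ->
  (0 < k)%N -> (a <= 8 ^ k)%N ->
  has_free_rk_graph (q ^ n.+1 * a) (Kbip n.+2 ((n.+1)`! * d ^ n.+1 + 1))
    (h + a + 2 * 2 ^ k).
Proof.
move=> p_pr m_gt0 qE d_gt0 a_gt0 ah dha k_gt0 ak.
have h_gt0 := leq_trans a_gt0 ah.
split; first by rewrite -addnA addn_gt0 h_gt0.
have mn_gt0 : (0 < m * n.+1)%N by rewrite muln_gt0 m_gt0.
have [F charF cF] := pPrimePowerField p_pr mn_gt0.
have cFq : #|F| = (q ^ n.+1)%N by rewrite cF expnM qE.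
have cF1 : (#|F|.-1 = d * (\sum_(j < n.+1) q ^ j) * (h * a))%N.
  by rewrite cFq predn_exp -dha; lia.
have [w w_prim] : exists w : F, (h * a).-primitive_root w.
  by apply: finfield_prim_root; rewrite cF1 dvdn_mull.
have q_char : [pchar F].-nat q by rewrite qE pnatX pnatE // charF.
have [G2 [lab2 [lab2_rk G2_free]]] := exists_C4_free_labelling k_gt0 ak.
have unit_exp (z : F) : z != 0 ->
    z ^+ (d * (\sum_(j < n.+1) q ^ j) * (h * a)) = 1.
  by move=> /finfield_expf_predn; rewrite cF1.
exists (@norm_graph F q d n h a w a_gt0 ah G2); split.
  rewrite -cFq -[X in (_ * X)%N]card_ord -card_prod.
  apply: rk_labelling_rk; refine (norm_labelling _ _ w_prim unit_exp lab2_rk).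
apply: union_copies_free => //; first by rewrite addn1.
  exact: norm_incidence_free.
apply: Kbip_free_mono G2_free => //.
by rewrite addn1 ltnS muln_gt0 fact_gt0 expn_gt0 d_gt0.
Qed.

Theorem theorem3p1 (R : realType) (t d : nat) (ht : (2 <= t)%N)
    (hd : (1 <= d)%N) :
  exists C : R,
    forall (p m q a h : nat),
      prime p -> odd p -> (0 < m)%N -> q = (p ^ (2 * m))%N ->
      (d %| q - 1)%N ->
      (0 < a)%N -> (a <= h)%N -> (h * a = (q - 1) %/ d)%N ->
      exists k : nat,
        f_is (q ^ (t - 1) * a)%N
             (Kbip t ((t - 1)`! * d ^ (t - 1) + 1)%N) k /\
        k%:R <= a%:R + h%:R + C * (h%:R `^ (2%:R / 5%:R)).
Proof.
(* The filler parts have size 2 * 2^k, with 2^k at most 4 h^(2/5); hence the constant 8. *)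
case: t ht => [|[|n]] // _; exists 8.
move=> p m q a h p_pr _ m_gt0 qE dq a_gt0 ah ha.
have h_gt0 := leq_trans a_gt0 ah.
(* This [k] is positive and satisfies a < 8^k <= 8 a, so the filler graph exists and its parts stay
   small. *)
rewrite subSS subn0; set k := (trunc_log 8 a).+1.
have [] := @f_is_le _ _ _ (@free_rk_graph_exists p (2 * m) q d n h a k
  p_pr _ qE hd a_gt0 ah _ isT _).
- by rewrite muln_gt0.
- by rewrite ha mulnC divnK // subn1.
- by rewrite ltnW // trunc_log_ltn.
move=> k0 fk k0_le; exists k0; split=> //.
have kh : (8 ^ k <= 8 * h)%N.
  by rewrite expnS leq_mul2l (leq_trans _ ah) // trunc_logP.
apply: (@le_trans _ _ (h + a + 2 * 2 ^ k)%:R); first by rewrite ler_nat.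
have -> : (h + a + 2 * 2 ^ k)%:R = a%:R + h%:R + 2 * (2 ^ k)%:R :> R.
  by rewrite -natrM -!natrD [(a + h)%N]addnC.
have -> : 8 = 2 * 4 :> R by rewrite -natrM.
rewrite lerD2l -mulrA ler_pM2l ?ltr0n //.
exact: pow_le_powR.
Qed.
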